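(* Let $n$ be an integer with $n\equiv 2\pmod 4$ and let $j\ge1$ be an integer. Then the Conway polynomial of the generalized Fibonacci link $\mathcal{F}_j^{(n)}=\mathcal{C}(\underbrace{n,n,\ldots,n}_{j})$ is congruent modulo $2$ to the Fibonacci polynomial $f_{j+1}(z)$.
   Context: Fibonacci polynomials: $f_0(z)=0$, $f_1(z)=1$, $f_{m+1}(z)=z f_m(z)+f_{m-1}(z)$. Rational links: $\mathcal{C}(a_1,\ldots,a_m)$ denotes the rational (two-bridge) link with Conway normal form $(a_1,\ldots,a_m)$: its standard diagram consists of $m$ consecutive twist regions, the $i$-th having $|a_i|$ crossings, where for odd $i$ right twists count as positive and for even $i$ right twists count as negative (so that the diagram is alternating when all $a_i$ have the same sign). Its Schubert fraction is $\frac{\alpha}{\beta}=[a_1,\ldots,a_m]=a_1+\cfrac{1}{a_2+\cfrac{1}{\cdots+\cfrac{1}{a_m}}}$. The link is a knot if $\alpha$ is odd and has two components if $\alpha$ is even. Orientation convention (needed only for two-component links): a link $\mathcal{C}(2a_1,\ldots,2a_m)$ with all entries even is oriented so that the two strands in each twist region are antiparallel. The Conway polynomial is normalized by $\nabla=1$ for the unknot and the skein relation $\nabla_{L_+}-\nabla_{L_-}=z\nabla_{L_0}$ (signs are irrelevant modulo 2). *)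

(* Defs.v *)
From HB Require Import structures.
From mathcomp Require Import all_boot all_order all_algebra.

Set Implicit Arguments.
Unset Strict Implicit.
Unset Printing Implicit Defensive.

Import GRing.Theory.
Local Open Scope ring_scope.

Fixpoint fib_poly (m : nat) : {poly int} :=
  match m with
  | 0 => 0
  | m1.+1 => if m1 is m2.+1 then 'X * fib_poly m1 + fib_poly m2 else 1
  end.

(* Oriented link diagrams are plane diagrams in Morse position, read from
   bottom to top as a sequence of elementary pieces.  A piece [(i, g)] is
   placed with exactly [i] strands passing on its left.  The strands of a
   horizontal section, from left to right, are recorded by their directions:
   [true] for upwards, [false] for downwards.
   - [Cup d]: a local minimum whose left branch has direction [d];
   - [Cap]: a local maximum;
   - [Crossing r]: if [r] is true, the over-strand runs from lower left to
     upper right, so that a pile of such crossings is a right-handed twist;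
     if [r] is false it runs from lower right to upper left.               *)
Inductive generator := Cup of bool | Cap | Crossing of bool.

Definition piece : Type := (nat * generator)%type.
Definition diagram : Type := seq piece.

Definition inputs (g : generator) : nat := if g is Cup _ then 0%N else 2%N.
Definition outputs (g : generator) : nat := if g is Cap then 0%N else 2%N.

Definition act (g : generator) (t : seq bool) : option (seq bool) :=
  match g, t with
  | Cup d, _ => Some [:: d, ~~ d & t]
  | Cap, [:: x, y & t'] => if x != y then Some t' else None
  | Crossing _, [:: x, y & t'] => Some [:: y, x & t']
  | _, _ => None
  end.

Definition step (s : seq bool) (p : piece) : option (seq bool) :=
  if (p.1 <= size s)%N then omap (cat (take p.1 s)) (act p.2 (drop p.1 s))
  else None.

(* The section above [D] if the section below it is [s]; [None] if some piece
   does not fit or the orientations do not match. *)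
Fixpoint section_above (s : seq bool) (D : diagram) : option (seq bool) :=
  if D is p :: D' then obind (section_above^~ D') (step s p) else Some s.

Definition is_link (D : diagram) : bool := section_above [::] D == Some [::].

(* Planar isotopies and Reidemeister moves for diagrams in Morse position
   (the Freyd-Yetter-Turaev presentation of the category of tangles). *)
Inductive move : diagram -> diagram -> Prop :=
  | move_far i k g h :
      move [:: (i, g); ((i + outputs g + k)%N, h)]
           [:: ((i + inputs g + k)%N, h); (i, g)]
  | move_zigzag_l i d : move [:: (i, Cup d); (i.+1, Cap)] [::]
  | move_zigzag_r i d : move [:: (i.+1, Cup d); (i, Cap)] [::]
  | move_slide_cap i r :
      move [:: (i, Crossing r); (i.+1, Cap)]
           [:: (i.+1, Crossing (~~ r)); (i, Cap)]
  | move_slide_cup i d r :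
      move [:: (i, Cup d); (i.+1, Crossing r)]
           [:: (i.+1, Cup d); (i, Crossing (~~ r))]
  | move_R1_cap i r : move [:: (i, Crossing r); (i, Cap)] [:: (i, Cap)]
  | move_R1_cup i d r :
      move [:: (i, Cup d); (i, Crossing r)] [:: (i, Cup (~~ d))]
  | move_R2 i r : move [:: (i, Crossing r); (i, Crossing (~~ r))] [::]
  (* The side condition excludes the two cyclic over/under patterns. *)
  | move_R3 i r1 r2 r3 : (r1 == r2) || (r2 == r3) ->
      move [:: (i, Crossing r1); (i.+1, Crossing r2); (i, Crossing r3)]
           [:: (i.+1, Crossing r3); (i, Crossing r2); (i.+1, Crossing r1)].

Inductive isotopic : diagram -> diagram -> Prop :=
  | isotopic_move u w1 w2 v :
      is_link (u ++ w1 ++ v) -> is_link (u ++ w2 ++ v) -> move w1 w2 ->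
      isotopic (u ++ w1 ++ v) (u ++ w2 ++ v)
  | isotopic_refl D : isotopic D D
  | isotopic_sym D1 D2 : isotopic D1 D2 -> isotopic D2 D1
  | isotopic_trans D1 D2 D3 :
      isotopic D1 D2 -> isotopic D2 D3 -> isotopic D1 D3.

(* The oriented smoothing of a crossing whose lower left and lower right ends
   have directions [x] and [y]. *)
Definition smoothing (i : nat) (x y : bool) : diagram :=
  if x == y then [::] else [:: (i, Cap); (i, Cup y)].

(* [Crossing r] is a positive crossing when [r] is true and its strands are
   parallel, or [r] is false and they are antiparallel; that is, when
   [r = (x == y)] for the directions [x], [y] of its lower ends.
   Only the values of [nabla] on diagrams satisfying [is_link] matter. *)
Record is_conway_polynomial (nabla : diagram -> {poly int}) : Prop := {
  conway_isotopic : forall D1 D2, is_link D1 -> is_link D2 ->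
    isotopic D1 D2 -> nabla D1 = nabla D2;
  conway_unknot : forall d, nabla [:: (0%N, Cup d); (0%N, Cap)] = 1;
  conway_skein : forall (u v : diagram) (i : nat) (s : seq bool),
    section_above [::] u = Some s ->
    is_link (u ++ (i, Crossing true) :: v) ->
    let x := nth true s i in
    let y := nth true s i.+1 in
    nabla (u ++ (i, Crossing (x == y)) :: v)
      - nabla (u ++ (i, Crossing (x != y)) :: v)
    = 'X * nabla (u ++ smoothing i x y ++ v) }.

(* The standard diagram of C(a_1, ..., a_m), drawn along the vertical axis, is
   a 4-plat on the strands 0, 1, 2, 3.  Entries are indexed from 0, so the
   region of index [k] is the twist of the entry a_(k+1): it involves the
   strands 1, 2 for even [k] and the strands 0, 1 for odd [k]. *)
Definition twist_position (k : nat) : nat := if odd k then 0%N else 1%N.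

Definition twist_region (k : nat) (x : int) : diagram :=
  nseq `|x|%N (twist_position k, Crossing ((0 < x) (+) odd k)).

Definition first_regions (a : seq int) (k : nat) : diagram :=
  flatten [seq twist_region l a`_l | l <- iota 0 k].

(* The orientation of the diagram is given by the directions [d0], [d1] of the
   left branches of its two minima. *)
Definition plat_bottom (d0 d1 : bool) : diagram :=
  [:: (0%N, Cup d0); (2%N, Cup d1)].

(* The maxima join 0-1 and 2-3 if the last region is on the strands 1, 2, and
   join 1-2 and 0-3 if it is on the strands 0, 1. *)
Definition plat_top (m : nat) : diagram :=
  if odd m then [:: (0%N, Cap); (0%N, Cap)] else [:: (1%N, Cap); (0%N, Cap)].

Definition rational_link (d0 d1 : bool) (a : seq int) : diagram :=
  plat_bottom d0 d1 ++ first_regions a (size a) ++ plat_top (size a).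

(* The directions are read at the bottom of each region; each crossing
   of the region exchanges the two strands.  If all entries are even, the
   condition only restricts the orientation of two-component links: when
   [size a] is even, [is_link (rational_link d0 d1 a)] already forces
   [d0 = d1], and both strand orientations of the knot satisfy it. *)
Definition antiparallel_twists (d0 d1 : bool) (a : seq int) : Prop :=
  forall (k : nat) (s : seq bool), (k < size a)%N ->
    section_above [::] (plat_bottom d0 d1 ++ first_regions a k) = Some s ->
    nth true s (twist_position k) != nth true s (twist_position k).+1.

Definition eq_mod2 (p q : {poly int}) : Prop :=
  forall k : nat, (p`_k = q`_k %[mod 2])%Z.

(* Main.v *)
(* Expand along the last twist region of C(2b_1, ..., 2b_m).  Its strands are
   antiparallel, so switching one of its crossings cancels two of them, and the
   smoothing of a crossing untwists the rest and leaves C(2b_1, ..., 2b_(m-1)).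
   Once the region is empty, the previous one untwists as well and leaves
   C(2b_1, ..., 2b_(m-2)).  Hence N_m = N_(m-2) +- b_m z N_(m-1), which is the
   Fibonacci recursion modulo 2 when every b_i is odd. *)
Require Import Defs.
From HB Require Import structures.
From mathcomp Require Import all_boot all_order all_algebra.
From mathcomp Require Import ring zify.

Import GRing.Theory.
Local Open Scope ring_scope.

(** * Strand directions under moves and smoothings *)

Lemma section_above_cat s u v :
  section_above s (u ++ v) = obind (section_above^~ v) (section_above s u).
Proof. by elim: u s => [|p u IHu] s //=; case: (step s p). Qed.

Lemma step_cons x s i g :
  step (x :: s) (i.+1, g) = omap (cons x) (step s (i, g)).
Proof. by rewrite /step /= ltnS; case: ifP => //; case: act. Qed.

Definition shift_right (D : diagram) : diagram := [seq (p.1.+1, p.2) | p <- D].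

Lemma section_above_shift x s D :
  section_above (x :: s) (shift_right D) = omap (cons x) (section_above s D).
Proof.
elim: D s => [|[i g] D IHD] s //=; rewrite step_cons.
by case: (step s (i, g)) => //= s1; apply: IHD.
Qed.

(** A strand to the left of all pieces is carried along unchanged, so a local statement at position
    [i] reduces to position 0. A nonempty shifted diagram does not fit on the empty section, which
    settles that case. *)
Lemma section_above_ind (w1 w2 : nat -> diagram) i :
    (forall j, w1 j.+1 = shift_right (w1 j)) ->
    (forall j, w2 j.+1 = shift_right (w2 j)) ->
    (0 < size (w1 0%N))%N ->
    (forall s s', section_above s (w1 0%N) = Some s' ->
       section_above s (w2 0%N) = Some s') ->
  forall s s', section_above s (w1 i) = Some s' ->
    section_above s (w2 i) = Some s'.
Proof.
move=> shift1 shift2 w1_gt0 w12.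
have {}w1_gt0 j : (0 < size (w1 j))%N.
  by elim: j => // j IHj; rewrite shift1 size_map.
elim: i => // i IHi [|x s] s'; first by rewrite shift1; case: (w1 i) (w1_gt0 i).
rewrite shift1 shift2 !section_above_shift.
by case E: (section_above s (w1 i)) => [s1|] //= [<-]; rewrite (IHi _ _ E).
Qed.

(** At position 0 only a few directions matter and can be enumerated. The implication runs one way
    only: an empty right-hand side fits every section, while the pieces it replaces may not. *)
Lemma move_section w1 w2 : move w1 w2 -> forall s s',
  section_above s w1 = Some s' -> section_above s w2 = Some s'.
Proof.
case=> [i k g h|i d|i d|i r|i d r|i r|i d r|i r|i r1 r2 r3 _].
- apply: (section_above_ind (fun i => [:: (i, g); ((i + outputs g + k)%N, h)])
    (fun i => [:: ((i + inputs g + k)%N, h); (i, g)])) => // s s'.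
  rewrite !add0n /=.
  by case: g => [d||r]; rewrite ?add0n ?add2n;
    [|case: s => [|x [|y s]] //|case: s => [|x [|y s]] //];
    rewrite /= ?step_cons /=; rewrite /(step _ (0%N, _)) /= ?drop0 ?take0 /=;
    [|case: ifP => //= xy|];
    rewrite ?step_cons; case: (step s (k, h)) => //= s1;
    rewrite /(step _ (0%N, _)) /= ?drop0 ?take0 ?xy.
- apply: (section_above_ind (fun i => [:: (i, Cup d); (i.+1, Cap)])
    (fun=> [::])) => // -[|x s] s';
  rewrite /= /step /= ?drop0 ?take0 //=.
  by case: d x => -[].
- apply: (section_above_ind (fun i => [:: (i.+1, Cup d); (i, Cap)])
    (fun=> [::])) => // -[|x s] s';
  rewrite /= /step /= ?drop0 ?take0 //=.
  by case: d x => -[].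
- apply: (section_above_ind (fun i => [:: (i, Crossing r); (i.+1, Cap)])
    (fun i => [:: (i.+1, Crossing (~~ r)); (i, Cap)])) => //.
  move=> [|x [|y [|z s]]] s'; rewrite /= /step /= ?drop0 ?take0 //=.
  by case: x y z => [] [] [].
- apply: (section_above_ind (fun i => [:: (i, Cup d); (i.+1, Crossing r)])
    (fun i => [:: (i.+1, Cup d); (i, Crossing (~~ r))])) => //.
  by move=> [|x s] s'; rewrite /= /step /= ?drop0 ?take0.
- apply: (section_above_ind (fun i => [:: (i, Crossing r); (i, Cap)])
    (fun i => [:: (i, Cap)])) => //.
  move=> [|x [|y s]] s'; rewrite /= /step /= ?drop0 ?take0 //=.
  by case: x y => [] [].
- apply: (section_above_ind (fun i => [:: (i, Cup d); (i, Crossing r)])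
    (fun i => [:: (i, Cup (~~ d))])) => //.
  by move=> s s'; rewrite /= /step /= ?drop0 ?take0 /= negbK.
- apply: (section_above_ind
    (fun i => [:: (i, Crossing r); (i, Crossing (~~ r))]) (fun=> [::])) => //.
  by move=> [|x [|y s]] s'; rewrite /= /step /= ?drop0 ?take0.
apply: (section_above_ind
  (fun i => [:: (i, Crossing r1); (i.+1, Crossing r2); (i, Crossing r3)])
  (fun i => [:: (i.+1, Crossing r3); (i, Crossing r2); (i.+1, Crossing r1)]))
  => //.
by move=> [|x [|y [|z s]]] s'; rewrite /= /step /= ?drop0 ?take0.
Qed.

(** Parallel directions are unchanged by the exchange; antiparallel ones [x], [y] become [y],
    [~~ y], which is again the exchanged pair. Hence smoothing a link diagram gives a link
    diagram. *)
Lemma section_above_smoothing s i r s' : step s (i, Crossing r) = Some s' ->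
  section_above s (smoothing i (nth true s i) (nth true s i.+1)) = Some s'.
Proof.
elim: i s s' => [|i IHi] [|x s] s' //.
  case: s => [|y s]; rewrite /step /= ?drop0 //.
  by rewrite /smoothing => -[<-]; case: x y => [] [] //=;
    rewrite /step /= ?drop0 ?take0.
rewrite step_cons; case E: (step s _) => [s1|] //= [<-].
have -> b c : smoothing i.+1 b c = shift_right (smoothing i b c).
  by rewrite /smoothing; case: ifP.
by rewrite section_above_shift (IHi _ _ E).
Qed.

Lemma link_move u v w1 w2 : move w1 w2 ->
  is_link (u ++ w1 ++ v) -> is_link (u ++ w2 ++ v).
Proof.
rewrite /is_link !section_above_cat => w12.
case: (section_above [::] u) => [s|] //=; rewrite !section_above_cat.
case E: (section_above s w1) => [s1|] //=.
by rewrite (move_section _ _ w12 _ _ E).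
Qed.

Lemma link_switch u v i r r' :
  is_link (u ++ (i, Crossing r) :: v) -> is_link (u ++ (i, Crossing r') :: v).
Proof. by rewrite /is_link !section_above_cat. Qed.

(** * Skein computations in a single twist region *)

Section Conway.

Variable nabla : diagram -> {poly int}.
Hypothesis nablaP : is_conway_polynomial nabla.

Lemma nabla_move u v w1 w2 : move w1 w2 -> is_link (u ++ w1 ++ v) ->
  nabla (u ++ w1 ++ v) = nabla (u ++ w2 ++ v).
Proof.
move=> w12 link1; have link2 := link_move _ _ _ _ w12 link1.
by apply: (conway_isotopic nablaP) => //; apply: isotopic_move.
Qed.

Lemma nabla_untwist_cap u v i r t :
  is_link (u ++ nseq t (i, Crossing r) ++ (i, Cap) :: v) ->
  nabla (u ++ nseq t (i, Crossing r) ++ (i, Cap) :: v) =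
  nabla (u ++ (i, Cap) :: v).
Proof.
elim: t => // t IHt.
(* The topmost crossing is split off, since it is the one adjacent to the maximum. *)
rewrite -addn1 nseqD -!catA !(catA u (nseq t _)) => linkD.
have R1 := move_R1_cap i r.
rewrite (nabla_move (u ++ nseq t _) v _ _ R1 linkD) -catA IHt //.
by rewrite catA (link_move (u ++ nseq t _) v _ _ R1 linkD).
Qed.

(** Each Reidemeister I move reverses the direction label of the minimum, whence the parity of
    [t]. *)
Lemma nabla_untwist_cup u v i d r t :
  is_link (u ++ (i, Cup d) :: nseq t (i, Crossing r) ++ v) ->
  nabla (u ++ (i, Cup d) :: nseq t (i, Crossing r) ++ v) =
  nabla (u ++ (i, Cup (d (+) odd t)) :: v).
Proof.
elim: t d => [|t IHt] d linkD; first by rewrite addbF.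
have R1 := move_R1_cup i d r.
rewrite (nabla_move u (nseq t _ ++ v) _ _ R1 linkD) IHt.
  by rewrite /= addNb addbN.
exact: (link_move u (nseq t _ ++ v) _ _ R1 linkD).
Qed.

(** Antiparallel strands make the crossing positive exactly when [r] is false, which gives the
    sign. *)
Lemma nabla_switch u v i r s : section_above [::] u = Some s ->
  nth true s i != nth true s i.+1 ->
  is_link (u ++ (i, Crossing r) :: v) ->
  nabla (u ++ (i, Crossing r) :: v) = nabla (u ++ (i, Crossing (~~ r)) :: v)
    + (-1) ^+ r * 'X *
        nabla (u ++ [:: (i, Cap); (i, Cup (nth true s i.+1))] ++ v).
Proof.
move=> su xy linkD.
have := conway_skein nablaP su (link_switch _ _ _ _ true linkD).
rewrite /smoothing (negPf xy) /= => skein.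
by case: r {linkD}; rewrite ?expr1 ?expr0 -mulrA -skein; ring.
Qed.

(* The orientation of the minimum has been reversed by the [2 * t - 1] crossings
   left after the smoothing. *)
Lemma nabla_twist u v i r t s : section_above [::] u = Some s ->
  nth true s i != nth true s i.+1 ->
  is_link (u ++ nseq t.*2 (i, Crossing r) ++ v) ->
  nabla (u ++ nseq t.*2 (i, Crossing r) ++ v) = nabla (u ++ v)
    + (-1) ^+ r * t%:R * 'X *
        nabla (u ++ [:: (i, Cap); (i, Cup (nth true s i))] ++ v).
Proof.
move=> su xy; elim: t => [|t IHt] linkD; first by rewrite mulr0 !mul0r addr0.
have R2 := move_R2 i (~~ r); rewrite negbK in R2.
rewrite doubleS -[nseq _ _]/((i, Crossing r) :: nseq t.*2.+1 _) cat_cons.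
rewrite (nabla_switch _ _ _ _ _ su xy linkD).
have link2 : is_link (u ++ [:: (i, Crossing (~~ r)); (i, Crossing r)] ++
    nseq t.*2 (i, Crossing r) ++ v) by exact: link_switch linkD.
rewrite (nabla_move u _ _ _ R2 link2) IHt; last first.
  exact: (link_move u _ _ _ R2 link2).
(* With the new maximum counted in the lower part, the [2 * t + 1] remaining crossings sit directly
   on the new minimum. *)
have link3 : is_link ((u ++ [:: (i, Cap)]) ++ (i, Cup (nth true s i.+1)) ::
    nseq t.*2.+1 (i, Crossing r) ++ v).
  move: linkD; rewrite /is_link -catA !section_above_cat su /=.
  case E: (step s _) => [s1|] //=.
  move: (section_above_smoothing _ _ _ _ E); rewrite /smoothing (negPf xy) /=.
  by case: (step s (i, Cap)) => //= s2; case: (step s2 _) => //= s3 [->].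
have := nabla_untwist_cup _ _ _ _ _ _ link3; rewrite -!catA /= => ->.
have -> : nth true s i.+1 (+) ~~ odd t.*2 = nth true s i.
  by rewrite odd_double addbT; case: (nth _ _ _) (nth _ _ _) xy => [] [].
rewrite -natr1; ring.
Qed.

(* Switching a crossing of a kink in the unknot does not change the unknot, and
   smoothing it gives two unlinked circles. *)
Lemma nabla_unlink d :
  nabla [:: (0%N, Cup d); (0%N, Cap); (0%N, Cup d); (0%N, Cap)] = 0.
Proof.
(* Two crossings are used so that [nabla_twist] applies with [t = 1]; both also untwist at the
   maximum, so 'X times the desired value vanishes. *)
have linkD : is_link ([:: (0%N, Cup d)] ++
    nseq 1.*2 (0%N, Crossing true) ++ [:: (0%N, Cap)]) by case: d.
have d_neq : nth true [:: d; ~~ d] 0%N != nth true [:: d; ~~ d] 1%N.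
  by case: d {linkD}.
have := nabla_twist [:: (0%N, Cup d)] _ _ _ _ _ erefl d_neq linkD.
rewrite nabla_untwist_cap //= => /eqP; rewrite -subr_eq0 opprD addNKr oppr_eq0.
by rewrite expr1 !mulf_eq0 oppr_eq0 oner_eq0 polyX_eq0 => /eqP.
Qed.

(** * The recursion for 4-plats with even entries *)

Definition open_plat (d : bool) (a : seq int) (k : nat) : diagram :=
  plat_bottom d d ++ first_regions a k.

(** The open part is kept separate because the skein relation is applied with it as the fixed lower
    part [u]. *)
Definition plat (d : bool) (a : seq int) (k : nat) : diagram :=
  open_plat d a k ++ plat_top k.

Lemma open_platS d a k :
  open_plat d a k.+1 = open_plat d a k ++ twist_region k a`_k.
Proof.
rewrite /open_plat /first_regions -addn1 iotaD map_cat flatten_cat catA.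
by rewrite /= cats0.
Qed.

Section EvenEntries.

Variables (d : bool) (a : seq int).
Hypothesis even_a : forall k, ~~ odd `|(a`_k)%R|%N.

Lemma twist_regionE k : twist_region k a`_k = nseq `|(a`_k)%R|./2.*2
  (twist_position k, Crossing ((0 < a`_k) (+) odd k)).
Proof. by rewrite /twist_region even_halfK. Qed.

(** An even number of crossings restores the order of the two strands, so the directions alternate
    above every region and each region is antiparallel. *)
Lemma section_open_plat k :
  section_above [::] (open_plat d a k) = Some [:: d; ~~ d; d; ~~ d].
Proof.
elim: k => // k IHk; rewrite open_platS section_above_cat IHk twist_regionE /=.
by elim: _./2 => // t; rewrite doubleS /twist_position; case: (odd k).
Qed.

Lemma link_open_plat k w :
  section_above [:: d; ~~ d; d; ~~ d] w = Some [::] ->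
  is_link (open_plat d a k ++ w).
Proof.
by rewrite /is_link section_above_cat section_open_plat /= => ->.
Qed.

Lemma section_plat_top k :
  section_above [:: d; ~~ d; d; ~~ d] (plat_top k) = Some [::].
Proof. by rewrite /plat_top; case: (odd k); case: d. Qed.

Lemma nabla_region k : nabla (plat d a k.+1) =
  nabla (open_plat d a k ++ plat_top k.+1) +
  (-1) ^+ ((0 < a`_k) (+) odd k) * `|(a`_k)%R|./2%:R * 'X * nabla (plat d a k).
Proof.
have linkN : is_link (open_plat d a k.+1 ++ plat_top k.+1).
  exact/link_open_plat/section_plat_top.
move: linkN; rewrite /plat open_platS twist_regionE -catA => linkN.
rewrite (nabla_twist _ _ _ _ _ _ (section_open_plat k) _ linkN); last first.
  by rewrite /twist_position; case: (odd k); case: d.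
congr (_ + _ * _); rewrite /plat_top /= /twist_position.
(* The minimum created by the smoothing and the lower maximum of [plat_top k.+1] straighten out; the
   maximum of the smoothing takes over as the lower one of [plat_top k]. *)
have zigzag p q b : move [:: (p, Cup b); (q, Cap)] [::] ->
    section_above [:: d; ~~ d; d; ~~ d]
      [:: (p, Cap); (p, Cup b); (q, Cap); (0%N, Cap)] = Some [::] ->
  nabla (open_plat d a k ++ [:: (p, Cap); (p, Cup b); (q, Cap); (0%N, Cap)]) =
  nabla (open_plat d a k ++ [:: (p, Cap); (0%N, Cap)]).
  move=> mv /(link_open_plat k) linkD.
  have := nabla_move (open_plat d a k ++ [:: (p, Cap)]) [:: (0%N, Cap)] _ _ mv.
  by rewrite -!catA; apply.
by case: (odd k) => /=; apply: zigzag; try constructor; case: (d).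
Qed.

Lemma nabla_plat0 : nabla (plat d a 0) = 1.
Proof.
have link0 : is_link (open_plat d a 0 ++ plat_top 0).
  exact/link_open_plat/section_plat_top.
have mv := move_zigzag_r 1 d.
by rewrite /plat (nabla_move [:: (0%N, Cup d)] [:: (0%N, Cap)] _ _ mv link0)
  (conway_unknot nablaP).
Qed.

Lemma nabla_plat1 :
  nabla (plat d a 1) = (-1) ^+ (0 < a`_0)%R * `|(a`_0)%R|./2%:R * 'X.
Proof.
rewrite nabla_region nabla_plat0 mulr1 addbF -[RHS]add0r; congr (_ + _).
(* The emptied region leaves two circles side by side; they are the stacked circles of
   [nabla_unlink] with the second minimum moved below the first maximum. *)
have mv := move_far 0 0 Cap (Cup d).
have unlinkP : is_link ([:: (0%N, Cup d)] ++ [:: (0%N, Cap); (0%N, Cup d)] ++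
  [:: (0%N, Cap)]) by case: d.
by rewrite -[RHS](nabla_unlink d) (nabla_move _ _ _ _ mv unlinkP).
Qed.

(** The top depends only on parity, so [plat_top k.+2] is [plat_top k], and its lower maximum joins
    the two strands of region [k]. *)
Lemma nabla_platSS k : nabla (plat d a k.+2) =
  nabla (plat d a k) +
  (-1) ^+ ((0 < a`_k.+1) (+) odd k.+1) * `|(a`_k.+1)%R|./2%:R * 'X *
    nabla (plat d a k.+1).
Proof.
rewrite nabla_region; congr (_ + _).
have : is_link (open_plat d a k.+1 ++ plat_top k.+2).
  exact/link_open_plat/section_plat_top.
rewrite /plat open_platS -catA; move: (open_plat d a k) => u.
rewrite /plat_top /= negbK /twist_region /twist_position.
by case: (odd k) => linkD; rewrite nabla_untwist_cap.
Qed.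

End EvenEntries.
End Conway.

(** * Reduction modulo 2 and the Fibonacci recursion *)

Lemma eq_mod2P p q :
  eq_mod2 p q <-> map_poly (intr : int -> 'F_2) p = map_poly intr q.
Proof.
have eqF (x y : int) : (x == y %[mod 2])%Z = (x%:~R == y%:~R :> 'F_2).
  rewrite eqz_mod_dvd (dvdz_pcharf (pchar_Fp (isT : prime 2))).
  by rewrite intrB subr_eq0.
split=> [pq|/polyP pq k].
  by apply/polyP=> k; rewrite !coef_map /=; apply/eqP; rewrite -eqF (pq k).
by apply/eqP; rewrite eqF; apply/eqP; have := pq k; rewrite !coef_map.
Qed.

(** Over 'F_2 the sign disappears and the odd number [t] becomes 1. *)
Lemma eq_mod2_fib_step (b : bool) t p q p' q' : odd t ->
    eq_mod2 p p' -> eq_mod2 q q' ->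
  eq_mod2 (p + (-1) ^+ b * t%:R * 'X * q) ('X * q' + p').
Proof.
have char2 : 2 \in [pchar {poly 'F_2}].
  by rewrite pchar_poly (pchar_Fp (isT : prime 2)).
move=> odd_t /eq_mod2P pp' /eq_mod2P qq'; apply/eq_mod2P.
rewrite addrC !rmorphD !rmorphM rmorph_sign rmorph_nat /= pp' qq'.
rewrite (oppr_pchar2 char2) expr1n mul1r -(odd_double_half t) odd_t natrD.
by rewrite -muln2 natrM (pcharf0 char2) mulr0 addr0 mul1r.
Qed.

Theorem corollary7 (nabla : diagram -> {poly int})
    (Hnabla : is_conway_polynomial nabla)
    (n : int) (Hn : (n = 2 %[mod 4])%Z) (j : nat) (Hj : (1 <= j)%N)
    (d0 d1 : bool)
    (Hlink : is_link (rational_link d0 d1 (nseq j n)))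
    (Horient : antiparallel_twists d0 d1 (nseq j n)) :
  eq_mod2 (nabla (rational_link d0 d1 (nseq j n))) (fib_poly j.+1).
Proof.
(* The first region twists strands 1 and 2, of directions [~~ d0] and [d1]. *)
have d01 : d0 = d1.
  have := Horient 0%N [:: d0; ~~ d0; d1; ~~ d1]; rewrite size_nseq.
  by move=> /(_ Hj erefl); case: (d0) (d1) => [] [].
have odd_n : odd `|n|./2 by lia.
(* Beyond the list the default entry is 0, which is even too. *)
have even_a k : ~~ odd `|((nseq j n)`_k)%R| by rewrite nth_nseq; case: ifP; lia.
rewrite /rational_link {}d01 size_nseq catA -/(open_plat _ _ _) -/(plat _ _ _).
pose N k := nabla (plat d1 (nseq j n) k).
(* The recursion has order two, so two consecutive values are carried; the bounds keep every entry
   involved equal to [n]. *)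
suff H k : (k <= j)%N -> eq_mod2 (N k) (fib_poly k.+1) /\
    ((k < j)%N -> eq_mod2 (N k.+1) (fib_poly k.+2)) by case: (H j).
elim: k => [|k IHk] lekj.
  split=> [|_]; rewrite /N ?nabla_plat0 // nabla_plat1 // nth_nseq Hj.
  (* The value for one entry is put in the form of a recursion step from 0 and 1, matching
     [fib_poly 0] and [fib_poly 1]. *)
  rewrite -[X in eq_mod2 X]add0r -[X in eq_mod2 (0 + X)]mulr1.
  exact: eq_mod2_fib_step.
have [IH0 /(_ lekj) IH1] := IHk (ltnW lekj); split=> // ltkj.
by rewrite /N nabla_platSS // nth_nseq ltkj; apply: eq_mod2_fib_step.
Qed.
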